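(* Let $\mathcal{H}$ be a complex separable Hilbert space and $A\in\mathcal{B}(\mathcal{H})$ with a Riesz basis $\{e_j\}_{j\in J}$ of eigenvectors, $Ae_j=-\lambda_je_j$, where $\lambda_j\in\mathbb{C}_+$ for all $j$. Let $I$ be a countable index set and $g^i\in\mathcal{H}$ for $i\in I$, with expansions $g^i=\sum_j g^i_je_j$. Define $a^i:=\sum_j\frac{\sqrt2}{1+\lambda_j}g^i_je_j$ (equivalently $a^i=\sqrt2(I_{\mathcal{H}}-A)^{-1}g^i$) and $B:=(I_{\mathcal{H}}+A)(I_{\mathcal{H}}-A)^{-1}$, so that $Be_j=\mathfrak{h}(\lambda_j)e_j$. Then $\{e^{tA}g^i\}_{i\in I,\,t\in[0,\infty)}$ is a semi-continuous frame for $\mathcal{H}$ if and only if $\{B^na^i\}_{i\in I,\,n\in\mathbb{N}\cup\{0\}}$ is a frame for $\mathcal{H}$.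
   Context: A Riesz basis is a complete family $\{e_j\}$ for which there are $c,C>0$ with $c\sum|x_j|^2\le\|\sum x_je_j\|^2\le C\sum|x_j|^2$ for all finite sequences $(x_j)$. $\mathbb{C}_+=\{z:\mathrm{Re}\,z>0\}$, $\mathbb{D}=\{z:|z|<1\}$, $\mathfrak{h}(z)=\frac{1-z}{1+z}$ (a bijection $\mathbb{C}_+\leftrightarrow\mathbb{D}$); $I_{\mathcal{H}}$ is the identity. $e^{tA}:=\sum_{n\ge0}\frac{t^n}{n!}A^n$. A countable family $\{f_k\}\subset\mathcal{H}$ is a frame if there are $c,C>0$ with $c\|f\|^2\le\sum_k|\langle f,f_k\rangle|^2\le C\|f\|^2$ for all $f$. For a countable $\mathcal{G}\subset\mathcal{H}$ and an interval $\mathcal{T}\subset[0,\infty)$, $\{e^{tA}g\}_{g\in\mathcal{G},t\in\mathcal{T}}$ is a semi-continuous frame for $\mathcal{H}$ if there are constants $c,C>0$ such that $c\|f\|^2\le\sum_{g\in\mathcal{G}}\int_{\mathcal{T}}|\langle f,e^{tA}g\rangle|^2\,dt\le C\|f\|^2$ for all $f\in\mathcal{H}$. *)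

(* Defs.v *)
From mathcomp Require Import all_boot all_order all_algebra.
From mathcomp Require Import all_classical all_reals all_analysis.
From mathcomp Require Export complex.
Export GRing.Theory Num.Theory.

Set Implicit Arguments.
Unset Strict Implicit.
Unset Printing Implicit Defensive.

Local Open Scope ring_scope.
Local Open Scope classical_set_scope.

Definition cR (R : realType) (x : R) : R[i] := Complex x 0.

Definition cabs2 (R : realType) (z : R[i]) : R :=
  complex.Re z ^+ 2 + complex.Im z ^+ 2.

Definition hnorm (R : realType) (V : lmodType R[i]) (ip : V -> V -> R[i])
  (x : V) : R := Num.sqrt (complex.Re (ip x x)).

Definition hcvg (R : realType) (V : lmodType R[i]) (ip : V -> V -> R[i])
  (u : nat -> V) (l : V) : Prop :=
  forall eps : R, 0 < eps -> exists N : nat,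
    forall n : nat, (N <= n)%N -> hnorm ip (u n - l) < eps.

Definition hcauchy (R : realType) (V : lmodType R[i]) (ip : V -> V -> R[i])
  (u : nat -> V) : Prop :=
  forall eps : R, 0 < eps -> exists N : nat,
    forall m n : nat, (N <= m)%N -> (N <= n)%N -> hnorm ip (u m - u n) < eps.

Record is_separable_hilbert (R : realType) (V : lmodType R[i])
  (ip : V -> V -> R[i]) : Prop := {
  ip_addl : forall x y z : V, ip (x + y) z = ip x z + ip y z;
  ip_scalel : forall (a : R[i]) (x y : V), ip (a *: x) y = a * ip x y;
  ip_conj : forall x y : V, ip y x = (ip x y)^*;
  ip_ge0 : forall x : V, 0 <= ip x x;
  ip_def : forall x : V, ip x x = 0 -> x = 0;
  h_complete : forall u : nat -> V, hcauchy ip u -> exists l : V, hcvg ip u l;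
  h_separable : exists d : nat -> V, forall (x : V) (eps : R), 0 < eps ->
      exists n : nat, hnorm ip (x - d n) < eps }.

Definition bounded_op (R : realType) (V : lmodType R[i]) (ip : V -> V -> R[i])
  (A : V -> V) : Prop :=
  exists M : R, forall x : V, hnorm ip (A x) <= M * hnorm ip x.

Definition expop (R : realType) (V : lmodType R[i]) (ip : V -> V -> R[i])
  (A : V -> V) (t : R) (g : V) : V :=
  xget 0 [set l | hcvg ip
     (fun N => \sum_(n < N) cR (t ^+ n / (n`!)%:R) *: iter n A g) l].

Definition riesz_basis (R : realType) (V : lmodType R[i]) (ip : V -> V -> R[i])
  (J : countType) (e : J -> V) : Prop :=
  (forall (f : V) (eps : R), 0 < eps -> exists (s : seq J) (x : J -> R[i]),
      hnorm ip (f - \sum_(j <- s) x j *: e j) < eps) /\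
  exists c C : R, 0 < c /\ 0 < C /\
    forall (s : seq J) (x : J -> R[i]), uniq s ->
      c * \sum_(j <- s) cabs2 (x j) <= hnorm ip (\sum_(j <- s) x j *: e j) ^+ 2
      /\ hnorm ip (\sum_(j <- s) x j *: e j) ^+ 2 <= C * \sum_(j <- s) cabs2 (x j).

Definition frame (R : realType) (V : lmodType R[i]) (ip : V -> V -> R[i])
  (K : choiceType) (f : K -> V) : Prop :=
  exists c C : R, 0 < c /\ 0 < C /\ forall x : V,
    ((c * hnorm ip x ^+ 2)%:E <= \esum_(k in [set: K]) (cabs2 (ip x (f k)))%:E)%E
    /\ (\esum_(k in [set: K]) (cabs2 (ip x (f k)))%:E <= (C * hnorm ip x ^+ 2)%:E)%E.

Definition semicont_frame (R : realType) (V : lmodType R[i]) (ip : V -> V -> R[i])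
  (A : V -> V) (G : choiceType) (g : G -> V) (T : set R) : Prop :=
  exists c C : R, 0 < c /\ 0 < C /\ forall x : V,
    ((c * hnorm ip x ^+ 2)%:E <=
       \esum_(i in [set: G]) \int[lebesgue_measure]_(t in T)
           (cabs2 (ip x (expop ip A t (g i))))%:E)%E
    /\ (\esum_(i in [set: G]) \int[lebesgue_measure]_(t in T)
           (cabs2 (ip x (expop ip A t (g i))))%:E <= (C * hnorm ip x ^+ 2)%:E)%E.

(* Main.v *)
Require Import Defs.
From mathcomp Require Import all_boot all_order all_algebra.
From mathcomp Require Import all_classical all_reals all_analysis.
From mathcomp Require Import measurable_realfun complex.
From mathcomp Require Import ring lra.
Import Order.TTheory GRing.Theory Num.Theory.
Import numFieldNormedType.Exports.
Set Implicit Arguments.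
Unset Strict Implicit.
Unset Printing Implicit Defensive.
Local Open Scope ring_scope.
Local Open Scope classical_set_scope.

(** Both frame sums agree term by term: for all [x] and [i],
    [\int_0^oo |<x, e^{tA} g^i>|^2 dt = \sum_n |<x, B^n a^i>|^2] in [[0, +oo]].
    Since [sqrt 2 a = (B + 1) g] and [sqrt 2 A a = (B - 1) g], a bounded real
    functional [l] gives, with [q_n t = l (e^{tA} B^n g)] and
    [y_n t = l (e^{tA} B^n a)], the derivative
    [(y_n ^ 2)' = q_{n+1} ^ 2 - q_n ^ 2]. Telescoping and integrating,
    [\int_0^T q_m ^ 2 + \sum_{n<m} y_n(0) ^ 2
       = \int_0^T q_0 ^ 2 + \sum_{n<m} y_n(T) ^ 2].
    In the Riesz basis [B] and [e^{tA}] are diagonal with multipliers of modulus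
    less than 1 (for [t > 0]), so [B^m] and [e^{TA}] are uniformly bounded and
    tend strongly to 0; letting [m] or [T] tend to infinity yields one
    inequality each. *)

(** * Squared modulus of complex numbers *)

Section complex_modulus.
Context {R : realType}.
Implicit Types z w : R[i].

Lemma cabs2_ge0 z : 0 <= cabs2 z.
Proof. by rewrite /cabs2 addr_ge0 ?sqr_ge0. Qed.

Lemma cabs2_eq0 z : (cabs2 z == 0) = (z == 0).
Proof.
by rewrite /cabs2 paddr_eq0 ?sqr_ge0// !sqrf_eq0 eq_complex.
Qed.

Lemma cabs2M z w : cabs2 (z * w) = cabs2 z * cabs2 w.
Proof. by case: z w => [a b] [c d]; rewrite /cabs2 /=; ring. Qed.

Lemma cabs2X z n : cabs2 (z ^+ n) = cabs2 z ^+ n.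
Proof.
elim: n => [|n IH]; last by rewrite !exprS cabs2M IH.
by rewrite !expr0 /cabs2 /= expr0n/= addr0 expr1n.
Qed.

Lemma cabs2_cR (s : R) : cabs2 (cR s) = s ^+ 2.
Proof. by rewrite /cabs2 /= expr0n/= addr0. Qed.

Lemma cabs2_conj z : cabs2 (z^*)%C = cabs2 z.
Proof. by case: z => a b; rewrite /cabs2 /= sqrrN. Qed.

Lemma cabs2V z : cabs2 z^-1 = (cabs2 z)^-1.
Proof.
have [->|z0] := eqVneq z 0; first by rewrite invr0 /cabs2 /= expr0n/= addr0 invr0.
have cz : cabs2 z != 0 by rewrite cabs2_eq0.
by apply: (mulfI cz); rewrite -cabs2M !divff// /cabs2 /= expr0n/= expr1n addr0.
Qed.

Lemma cRM (s t : R) : cR (s * t) = cR s * cR t.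
Proof. by rewrite /cR; apply/eqP; rewrite eq_complex /= !mulr0 !mul0r subr0 addr0 !eqxx. Qed.

Lemma cRD (s t : R) : cR (s + t) = cR s + cR t.
Proof. by apply/eqP; rewrite eq_complex /= addr0 !eqxx. Qed.

End complex_modulus.

(** * Real null sequences *)

Section real_limits.
Context {R : realType}.

Lemma cvg0_le (u v : R^nat) : (forall n, 0 <= u n <= v n) ->
  v @ \oo --> (0 : R) -> u @ \oo --> (0 : R).
Proof.
move=> uv v0; apply: (@squeeze_cvgr _ _ _ _ (fun _ => 0) v) => //.
  exact: nearW.
exact: cvg_cst.
Qed.

Lemma sqrt_cvg0 (u : R^nat) : u @ \oo --> (0 : R) ->
  (fun n => Num.sqrt (u n)) @ \oo --> (0 : R).
Proof.
move=> u0; rewrite -[X in _ --> X]sqrtr0.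
by apply: continuous_cvg => //; exact: sqrt_continuous.
Qed.

End real_limits.

(** * Norm, limits and bounded maps in a Hilbert space *)

Section hilbert_space.
Context {R : realType} {V : lmodType R[i]} (ip : V -> V -> R[i]).
Hypothesis HV : is_separable_hilbert ip.

Local Notation N := (hnorm ip).
Local Notation rip x y := (complex.Re (ip x y)).

Lemma ipC x y : ip y x = (ip x y)^*%C.
Proof. exact: (ip_conj HV). Qed.

Lemma ip_addr x y z : ip x (y + z) = ip x y + ip x z.
Proof. by rewrite ipC (ip_addl HV) rmorphD /= -!ipC. Qed.

Lemma ip_scaler a x y : ip x (a *: y) = (a^*)%C * ip x y.
Proof. by rewrite ipC (ip_scalel HV) rmorphM /= -!ipC. Qed.

Lemma Re_ipC x y : rip x y = rip y x.
Proof. by rewrite (ipC y x); case: (ip y x). Qed.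

Lemma Re_ip_scale (s : R) x y : rip (cR s *: x) y = s * rip x y.
Proof. by rewrite (ip_scalel HV); case: (ip x y) => a b /=; rewrite mul0r subr0. Qed.

Lemma Re_ip_scaler (s : R) x y : rip x (cR s *: y) = s * rip x y.
Proof. by rewrite Re_ipC Re_ip_scale Re_ipC. Qed.

Lemma Re_ip_ge0 x : 0 <= rip x x.
Proof. by have := ip_ge0 HV x; rewrite lecE => /andP[]. Qed.

Lemma Im_ip_self x : complex.Im (ip x x) = 0.
Proof. by have := ip_ge0 HV x; rewrite lecE => /andP[/eqP]. Qed.

Lemma hnorm_sqr x : N x ^+ 2 = rip x x.
Proof. by rewrite sqr_sqrtr// Re_ip_ge0. Qed.

Lemma hnorm_ge0 x : 0 <= N x.
Proof. exact: sqrtr_ge0. Qed.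

Lemma hnorm_eq0 x : N x = 0 -> x = 0.
Proof.
move=> Nx; apply: (ip_def HV); apply/eqP; rewrite eq_complex Im_ip_self eqxx andbT.
by rewrite -hnorm_sqr Nx expr0n.
Qed.

(** The real quadratic [t |-> N (x + t y) ^ 2] is nonnegative; evaluating it at one well-chosen [t]
    gives the inequality for the real part, which is all that real functionals require. *)
Lemma cauchy_schwarz x y : `|rip x y| <= N x * N y.
Proof.
have expand (t : R) :
    rip (x + cR t *: y) (x + cR t *: y) = rip x x + 2 * t * rip x y + t ^+ 2 * rip y y.
  rewrite (ip_addl HV) !ip_addr !raddfD /= !Re_ip_scale !Re_ip_scaler (Re_ipC y x).
  by ring.
have quad t : 0 <= rip x x + 2 * t * rip x y + t ^+ 2 * rip y y.
  by rewrite -expand Re_ip_ge0.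
have xx := Re_ip_ge0 x; have yy := Re_ip_ge0 y.
have CS : rip x y ^+ 2 <= rip x x * rip y y.
  have [y0|y0] := eqVneq (rip y y) 0.
    (* With no quadratic term the expression is affine in [t]; unless its slope is zero, this [t]
       gives it the value -1, a contradiction. *)
    have := quad (- (rip x x + 1) / 2 * (rip x y)^-1); rewrite y0 !mulr0 addr0.
    have [->|xy0] := eqVneq (rip x y) 0; first by rewrite expr0n.
    rewrite (_ : 2 * _ * _ = - (rip x x + 1)); last by field.
    by lra.
  (* This is the minimiser of the quadratic. *)
  have := quad (- rip x y / rip y y).
  rewrite (_ : _ + _ = (rip x x * rip y y - rip x y ^+ 2) / rip y y); last by field.
  by rewrite pmulr_lge0 ?subr_ge0// invr_gt0 lt_neqAle eq_sym y0.
rewrite -(ler_pXn2r (ltn0Sn 1)) ?nnegrE ?mulr_ge0 ?hnorm_ge0 ?normr_ge0//.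
by rewrite real_normK ?num_real// exprMn !hnorm_sqr.
Qed.

Lemma hnorm_triangle x y : N (x + y) <= N x + N y.
Proof.
rewrite -(ler_pXn2r (ltn0Sn 1)) ?nnegrE ?addr_ge0 ?hnorm_ge0//.
rewrite sqrrD !hnorm_sqr (ip_addl HV) !ip_addr !raddfD /= (Re_ipC y x).
have := cauchy_schwarz x y; rewrite ler_norml => /andP[_]; lra.
Qed.

Lemma hnormZ z x : N (z *: x) = Num.sqrt (cabs2 z) * N x.
Proof.
rewrite /hnorm -sqrtrM ?cabs2_ge0//; congr Num.sqrt.
rewrite (ip_scalel HV) ip_scaler; have := Im_ip_self x.
by case: (ip x x) z => [a b] [c d] /= ->; rewrite /cabs2 /=; ring.
Qed.

Lemma hnormZR (s : R) x : N (cR s *: x) = `|s| * N x.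
Proof. by rewrite hnormZ cabs2_cR sqrtr_sqr. Qed.

Lemma hnormN x : N (- x) = N x.
Proof.
rewrite -scaleN1r hnormZ (_ : cabs2 _ = 1) ?sqrtr1 ?mul1r//.
by rewrite /cabs2 /= oppr0 expr0n/= addr0 sqrrN expr1n.
Qed.

Lemma hnorm0 : N 0 = 0.
Proof. by rewrite -(scale0r 0) hnormZ /cabs2 /= expr0n/= addr0 sqrtr0 mul0r. Qed.

Lemma hnorm_triangleB x y : N (x - y) <= N x + N y.
Proof. by rewrite (le_trans (hnorm_triangle _ _))// hnormN. Qed.

Lemma hdistC x y : N (x - y) = N (y - x).
Proof. by rewrite -hnormN opprB. Qed.

Lemma hnorm_distD z x y : N (x - y) <= N (x - z) + N (z - y).
Proof. by rewrite -[x - y](subrKA z) hnorm_triangle. Qed.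

Lemma hnorm_sum (I : Type) (s : seq I) (P : pred I) (f : I -> V) :
  N (\sum_(i <- s | P i) f i) <= \sum_(i <- s | P i) N (f i).
Proof.
elim/big_rec2: _ => [|i y x _ le_xy]; first by rewrite hnorm0.
by rewrite (le_trans (hnorm_triangle _ _))// lerD2l.
Qed.

Lemma hcvgP (u : nat -> V) (l : V) :
  hcvg ip u l <-> (fun n => N (u n - l)) @ \oo --> (0 : R).
Proof.
split=> [ul|/cvgrPdist_lt ul] eps.
  apply/(@cvgrPdist_lt _ R^o) : eps => eps e0; have [n un] := ul _ e0.
  by exists n => // m /= nm; rewrite sub0r normrN ger0_norm ?hnorm_ge0// un.
move=> /ul[n _ un]; exists n => m nm.
by have := un m nm; rewrite /= sub0r normrN ger0_norm ?hnorm_ge0.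
Qed.

Lemma hcvg_unique u l m : hcvg ip u l -> hcvg ip u m -> l = m.
Proof.
move=> /hcvgP ul /hcvgP um; apply/eqP; rewrite -subr_eq0; apply/eqP/hnorm_eq0.
have lm : (fun n => N (u n - l) + N (u n - m)) @ \oo --> (0 : R).
  by rewrite -[X in _ --> X]addr0; exact: cvgD.
apply: (@cvg_unique _ (@norm_hausdorff R R^o) ((fun=> N (l - m)) @ \oo)).
  exact: cvg_cst.
apply: cvg0_le lm => n; rewrite hnorm_ge0/=.
by rewrite (le_trans (hnorm_distD (u n) _ _))// hdistC.
Qed.

Lemma hcvgD u v l m : hcvg ip u l -> hcvg ip v m ->
  hcvg ip (fun n => u n + v n) (l + m).
Proof.
move=> /hcvgP ul /hcvgP vm; apply/hcvgP.
have lm : (fun n => N (u n - l) + N (v n - m)) @ \oo --> (0 : R).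
  by rewrite -[X in _ --> X]addr0; exact: cvgD.
by apply: cvg0_le lm => n; rewrite hnorm_ge0/= opprD addrACA hnorm_triangle.
Qed.

Lemma hcvg_hnorm u l : hcvg ip u l -> (fun n => N (u n)) @ \oo --> N l.
Proof.
move=> /hcvgP ul; apply/subr_cvg0; apply/norm_cvg0P; apply: cvg0_le ul => n.
rewrite normr_ge0 /= ler_norml; apply/andP; split.
  rewrite lerNl opprB lerBlDr -[leRHS]addrC -lerBlDl.
  have := hnorm_triangle (l - u n) (u n); rewrite subrK hdistC; lra.
have := hnorm_triangle (u n - l) l; rewrite subrK; lra.
Qed.

(* The increments are compared with those of a convergent real sequence, so
   that completeness applies without any series in [V]. *)
Lemma hcauchy_dominated (u : nat -> V) (v : R^nat) : cvgn v ->
  (forall m n, (m <= n)%N -> N (u n - u m) <= `|v n - v m|) -> hcauchy ip u.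
Proof.
move=> /cvg_ex[/= l /cvgrPdist_lt vl] uv eps e0.
have [n _ vn] := vl (eps / 2) (divr_gt0 e0 (ltr0Sn R 1)).
have le m p : (n <= m)%N -> (n <= p)%N -> `|v p - v m| < eps.
  move=> nm np; rewrite -(subrKA l) (le_lt_trans (ler_normD _ _))//.
  rewrite [ltRHS]splitr ltrD//; last exact: vn.
  by rewrite distrC; exact: vn.
exists n => m p nm np; have [mp|/ltnW pm] := leqP m p.
  by rewrite hdistC (le_lt_trans (uv _ _ mp))// le.
by rewrite (le_lt_trans (uv _ _ pm))// le.
Qed.

(** The explicit bound [K] lets one constant be shared by a whole family of operators. *)
Record bounded_linear (T : V -> V) (K : R) : Prop := {
  blD : forall x y, T (x + y) = T x + T y ;
  blZ : forall a x, T (a *: x) = a *: T x ;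
  bl_ge0 : 0 <= K ;
  bl_le : forall x, N (T x) <= K * N x }.

(** Only real-linear, so that both the real and the imaginary part of [ip x _] qualify; their
    squares add up to [cabs2 (ip x _)], which reduces the energy identity to real calculus. *)
Record real_functional (l : V -> R) (K : R) : Prop := {
  rfD : forall x y, l (x + y) = l x + l y ;
  rfZ : forall s x, l (cR s *: x) = s * l x ;
  rf_ge0 : 0 <= K ;
  rf_le : forall x, `|l x| <= K * N x }.

Section bounded_linear_theory.
Variables (T : V -> V) (K : R).
Hypothesis HT : bounded_linear T K.

Lemma bl0 : T 0 = 0.
Proof. by have := blZ HT 0 0; rewrite !scale0r. Qed.

Lemma blB x y : T (x - y) = T x - T y.
Proof. by rewrite (blD HT) -scaleN1r (blZ HT) scaleN1r. Qed.

Lemma bl_sum (I : Type) (s : seq I) (f : I -> V) :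
  T (\sum_(i <- s) f i) = \sum_(i <- s) T (f i).
Proof.
elim: s => [|i s IH]; first by rewrite !big_nil bl0.
by rewrite !big_cons (blD HT) IH.
Qed.

Lemma bl_hcvg u l : hcvg ip u l -> hcvg ip (fun n => T (u n)) (T l).
Proof.
move=> /hcvgP ul; apply/hcvgP.
have Kl : (fun n => K * N (u n - l)) @ \oo --> (0 : R).
  by rewrite -[X in _ --> X](mulr0 K); apply: cvgMr.
by apply: cvg0_le Kl => n; rewrite hnorm_ge0/= -blB (bl_le HT).
Qed.

Lemma bl_iter n : bounded_linear (iter n T) (K ^+ n).
Proof.
elim: n => [|n IH].
  by split=> //= x; rewrite ?expr0 ?mul1r.
split=> /= [x y|a x||x]; rewrite ?exprS.
- by rewrite (blD IH) (blD HT).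
- by rewrite (blZ IH) (blZ HT).
- by rewrite mulr_ge0 ?(bl_ge0 HT) ?(bl_ge0 IH).
- by rewrite (le_trans (bl_le HT _))// -mulrA ler_wpM2l ?(bl_ge0 HT) ?(bl_le IH).
Qed.

End bounded_linear_theory.

Section real_functional_theory.
Variables (l : V -> R) (K : R).
Hypothesis Hl : real_functional l K.

Lemma rf0 : l 0 = 0.
Proof. by have := rfZ Hl 0 0; rewrite mul0r (_ : cR 0 = 0)// scale0r. Qed.

Lemma rfB x y : l (x - y) = l x - l y.
Proof.
rewrite (rfD Hl) -scaleN1r (_ : -1 = cR (-1)) ?(rfZ Hl) ?mulN1r//.
by apply/eqP; rewrite eq_complex /= oppr0 !eqxx.
Qed.

Lemma rf_sum (I : Type) (s : seq I) (f : I -> V) :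
  l (\sum_(i <- s) f i) = \sum_(i <- s) l (f i).
Proof.
elim: s => [|i s IH]; first by rewrite !big_nil rf0.
by rewrite !big_cons (rfD Hl) IH.
Qed.

Lemma rf_cvg u m : hcvg ip u m -> (fun n => l (u n)) @ \oo --> l m.
Proof.
move=> /hcvgP um; apply/subr_cvg0; apply/norm_cvg0P.
have Km : (fun n => K * N (u n - m)) @ \oo --> (0 : R).
  by rewrite -[X in _ --> X](mulr0 K); apply: cvgMr.
by apply: cvg0_le Km => n; rewrite normr_ge0/= -rfB (rf_le Hl).
Qed.

End real_functional_theory.

Lemma real_functional_Re x : real_functional (fun y => complex.Re (ip x y)) (N x).
Proof.
split=> [y z|s y||y].
- by rewrite ip_addr raddfD.
- exact: Re_ip_scaler.
- exact: hnorm_ge0.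
- exact: cauchy_schwarz.
Qed.

(** Since [ip] is linear in its first slot, multiplying [x] by the imaginary unit turns imaginary
    parts into real ones, and bounds for real parts carry over. *)
Lemma Im_ipE x y : complex.Im (ip x y) = - complex.Re (ip (Complex 0 1 *: x) y).
Proof. by rewrite (ip_scalel HV); case: (ip x y) => a b /=; ring. Qed.

Lemma real_functional_Im x :
  real_functional (fun y => complex.Im (ip x y)) (N (Complex 0 1 *: x)).
Proof.
have HRe := real_functional_Re (Complex 0 1 *: x).
split=> [y z|s y||y]; rewrite ?Im_ipE ?normrN.
- by rewrite (rfD HRe) opprD.
- by rewrite (rfZ HRe) mulrN.
- exact: hnorm_ge0.
- exact: cauchy_schwarz.
Qed.

End hilbert_space.

(** * The exponential series of a bounded operator *)

Section operator_exponential.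
Context {R : realType} {V : lmodType R[i]} (ip : V -> V -> R[i]).
Hypothesis HV : is_separable_hilbert ip.
Variables (A : V -> V) (M : R).
Hypothesis HA : bounded_linear ip A M.

Local Notation N := (hnorm ip).
Local Notation E := (expop ip A).

Let psum t g n := \sum_(k < n) cR (t ^+ k / (k`!)%:R) *: iter k A g.

Lemma scale_bounded_linear (a : R[i]) :
  bounded_linear ip ( *:%R a) (Num.sqrt (cabs2 a)).
Proof.
split=> [x y|b x||x]; first exact: scalerDr.
- by rewrite !scalerA mulrC.
- exact: sqrtr_ge0.
- by rewrite (hnormZ HV).
Qed.

Let exp_term_le t g k :
  N (cR (t ^+ k / (k`!)%:R) *: iter k A g) <= N g * exp_coeff (`|t| * M) k.
Proof.
rewrite (hnormZR HV) normrM normrX normfV normr_nat /exp_coeff /= exprMn.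
rewrite (_ : N g * _ = `|t| ^+ k / k`!%:R * (M ^+ k * N g)); last by ring.
apply: ler_wpM2l; last exact: bl_le (bl_iter HA k) g.
by rewrite divr_ge0// exprn_ge0.
Qed.

(** The series is dominated by [N g] times the real series of [expR (|t| M)], so by completeness a
    limit exists and [xget] returns it rather than its default 0. *)
Lemma expop_cvg t g : hcvg ip (psum t g) (E t g).
Proof.
rewrite /expop; apply: xgetPex; apply: (h_complete HV).
apply: (@hcauchy_dominated _ _ _ HV _
  (fun n => N g * series (exp_coeff (`|t| * M)) n)).
  by apply: is_cvgMr; exact: is_cvg_series_exp_coeff.
move=> m n mn; rewrite -mulrBr sub_series_geq//.
rewrite -!(big_mkord xpredT (fun k => cR (t ^+ k / (k`!)%:R) *: iter k A g)).
rewrite (big_cat_nat (leq0n m) mn)/= addrAC subrr add0r.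
rewrite (le_trans (hnorm_sum HV _ _ _))// (le_trans _ (ler_norm _))//.
by rewrite mulr_sumr; apply: ler_sum => k _; exact: exp_term_le.
Qed.

Lemma expop_eq t g h : hcvg ip (psum t g) h -> E t g = h.
Proof. exact: (hcvg_unique HV (expop_cvg t g)). Qed.

Lemma expop0 g : E 0 g = g.
Proof.
apply: expop_eq => eps e0; exists 1%N => -[//|n] _.
rewrite /psum big_ord_recl big1 => [|k _].
  rewrite /= expr0 fact0 divr1 (_ : cR 1 = 1)// scale1r addr0 subrr.
  by rewrite (hnorm0 HV).
by rewrite exprS !mul0r (_ : cR 0 = 0)// scale0r.
Qed.

(** [T] commutes with every partial sum of the series, and passes to the limit by continuity. *)
Lemma expop_comm T K t g : bounded_linear ip T K ->
  (forall x, T (A x) = A (T x)) -> T (E t g) = E t (T g).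
Proof.
move=> HT TA; apply/esym/expop_eq.
have TAn k x : T (iter k A x) = iter k A (T x).
  by elim: k => //= k IH; rewrite TA IH.
rewrite (_ : psum _ _ = fun n => T (psum t g n)).
  exact: (bl_hcvg HT (expop_cvg t g)).
apply/funext => n; rewrite /psum (bl_sum HT).
by apply: eq_bigr => k _; rewrite (blZ HT) TAn.
Qed.

Lemma expop_bounded_linear t : bounded_linear ip (E t) (expR (`|t| * M)).
Proof.
split=> [x y|a x||x]; last 2 first.
- exact: expR_ge0.
- have := hcvg_hnorm HV (expop_cvg t x); rewrite mulrC => EN.
  have eN : (fun n => N x * series (exp_coeff (`|t| * M)) n) @ \oo
      --> N x * expR (`|t| * M).
    by apply: cvgMr; exact: is_cvg_series_exp_coeff.
  apply: (ler_cvg_to EN eN); apply: nearW => n; rewrite (le_trans (hnorm_sum HV _ _ _))// /series /= big_mkord.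
  by rewrite mulr_sumr; apply: ler_sum => k _; exact: exp_term_le.
- apply: expop_eq; rewrite (_ : psum _ _ = fun n => psum t x n + psum t y n).
    exact: (hcvgD HV (expop_cvg t x) (expop_cvg t y)).
  apply/funext => n; rewrite /psum -big_split; apply: eq_bigr => k _.
  by rewrite (blD (bl_iter HA k)) scalerDr.
- apply/esym/(@expop_comm ( *:%R a) _ t x (scale_bounded_linear a)) => z.
  by rewrite (blZ HA).
Qed.

(** Under [l] the exponential becomes a real power series with coefficients [l (A^n g) / n!];
    differentiating it termwise shifts the coefficients to those of [A g]. *)
Lemma is_derive_expop (l : V -> R) K t g : real_functional ip l K ->
  is_derive t (1 : R) (fun s => l (E s g)) (l (E t (A g))).
Proof.
move=> Hl; pose c g n : R := l (iter n A g) / n`!%:R.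
have cE s h : pseries (c h) s @ \oo --> l (E s h).
  rewrite (_ : pseries _ _ = fun n => l (psum s h n)).
    exact: (rf_cvg Hl (expop_cvg s h)).
  apply/funext => n; rewrite /pseries /series /= big_mkord (rf_sum Hl).
  by apply: eq_bigr => k _; rewrite (rfZ Hl) /c; ring.
have cA h : pseries_diffs (c h) = c (A h).
  apply/funext => n; rewrite /pseries_diffs /c -iterSr factS natrM.
  by rewrite invfM mulrCA mulVKf// pnatr_eq0.
have cc h s : cvgn (pseries (c h) s) by apply/cvg_ex; exists (l (E s h)).
have := @pseries_snd_diffs _ (c g) (`|t| + 1) t; rewrite !cA.
rewrite (cvg_lim _ (cE t (A g)))//.
rewrite (_ : (fun x => limn (pseries (c g) x)) = (fun s => l (E s g))); last first.
  by apply/funext => s; exact: cvg_lim (cE s g).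
(* Termwise differentiation at [t] asks for convergence at a point of larger modulus; [|t| + 1] is
   one, as the series converges everywhere. *)
by apply=> //; rewrite [ltRHS]ger0_norm ?addr_ge0// ltrDl.
Qed.

Lemma continuous_expop (l : V -> R) K g : real_functional ip l K ->
  continuous (fun s => l (E s g)).
Proof.
move=> Hl t; apply/differentiable_continuous/derivable1_diffP.
by have [] := is_derive_expop t g Hl.
Qed.

End operator_exponential.

(** * The exponential on an eigenvector *)

Section exponential_eigenvector.
Context {R : realType} {V : lmodType R[i]} (ip : V -> V -> R[i]).
Hypothesis HV : is_separable_hilbert ip.
Variables (A : V -> V) (M : R).
Hypothesis HA : bounded_linear ip A M.
Variables (e : V) (lam : R[i]).
Hypothesis Ae : A e = - lam *: e.

Local Notation N := (hnorm ip).
Local Notation E := (expop ip A).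

(** Bounding real and imaginary parts separately costs a factor of square root of 2, rounded up to
    2; the bound only serves to make a rank-one map continuous. *)
Lemma hcauchy_schwarz x y : Num.sqrt (cabs2 (ip x y)) <= 2 * N x * N y.
Proof.
have NxNy : 0 <= N x * N y by rewrite mulr_ge0 ?hnorm_ge0.
rewrite -(ler_pXn2r (ltn0Sn 1)) ?nnegrE -?mulrA ?mulr_ge0 ?sqrtr_ge0 ?hnorm_ge0//.
rewrite sqr_sqrtr ?cabs2_ge0// /cabs2 (Im_ipE HV) sqrrN.
have HRe := cauchy_schwarz HV x y.
have HIm := cauchy_schwarz HV (Complex 0 1 *: x) y.
have {}HIm : `|complex.Re (ip (Complex 0 1 *: x) y)| <= N x * N y.
  by rewrite (le_trans HIm)// (hnormZ HV) /cabs2 /= expr0n expr1n add0r sqrtr1 mul1r.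
have sq (a b : R) : `|a| <= b -> a ^+ 2 <= b ^+ 2.
  move=> ab; rewrite -(real_normK (num_real a)) ler_pXn2r ?nnegrE//.
  exact: le_trans ab.
by have := sq _ _ HRe; have := sq _ _ HIm; nra.
Qed.

(** Every partial sum is a multiple of [e], and on multiples of [e] the maps [z |-> ip e e *: z] and
    [z |-> ip z e *: e] agree; both are continuous. Hence [E t e] stays on the line of [e]. *)
Lemma expop_eigen_line t : ip e e *: E t e = ip (E t e) e *: e.
Proof.
apply: (hcvg_unique HV (bl_hcvg (scale_bounded_linear HV _) (expop_cvg HV HA t e))).
have rank1 : bounded_linear ip (fun z => ip z e *: e) (2 * N e * N e).
  split=> [x y|a x||x].
  - by rewrite (ip_addl HV) scalerDl.
  - by rewrite (ip_scalel HV) scalerA.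
  - by rewrite !mulr_ge0 ?hnorm_ge0.
  - rewrite (hnormZ HV) mulrAC ler_wpM2r ?hnorm_ge0//.
    by rewrite (le_trans (hcauchy_schwarz _ _))// mulrAC.
rewrite (_ : (fun n => _) = fun n => ip (\sum_(k < n) cR (t ^+ k / (k`!)%:R) *: iter k A e) e *: e).
  exact: (bl_hcvg rank1 (expop_cvg HV HA t e)).
apply/funext => n.
have An k : iter k A e = (- lam) ^+ k *: e.
  elim: k => [|k IH]; first by rewrite scale1r.
  by rewrite iterS IH (blZ HA) Ae scalerA exprSr.
under eq_bigr do rewrite An scalerA.
by rewrite -scaler_suml (ip_scalel HV) !scalerA mulrC.
Qed.

(** The function [w s = ip e (E s e)] satisfies [w' = - conj(lam) w], so
    [expR (2 Re(lam) s) |w s| ^ 2] has derivative zero. This yields the modulus without a complex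
    exponential. *)
Lemma expop_eigen_modulus t :
  cabs2 (ip e (E t e)) = expR (- (2 * complex.Re lam) * t) * cabs2 (ip e e).
Proof.
pose u s := complex.Re (ip e (E s e)); pose v s := complex.Im (ip e (E s e)).
pose al := complex.Re lam; pose be := complex.Im lam.
have EA s : E s (A e) = - (Complex al be) *: E s e.
  rewrite (_ : Complex al be = lam); last by rewrite /al /be; case: lam.
  by rewrite Ae (blZ (expop_bounded_linear HV HA s)).
have du s : is_derive s (1 : R) u (- (al * u s + be * v s)).
  apply: is_derive_eq (is_derive_expop HV HA s e (real_functional_Re HV e)) _.
  rewrite EA (ip_scaler HV) /u /v.
  by case: (ip e (E s e)) => a b /=; ring.
have dv s : is_derive s (1 : R) v (be * u s - al * v s).
  apply: is_derive_eq (is_derive_expop HV HA s e (real_functional_Im HV e)) _.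
  rewrite EA (ip_scaler HV) /u /v.
  by case: (ip e (E s e)) => a b /=; ring.
pose G s := expR (2 * al * s) * (u s ^+ 2 + v s ^+ 2).
have dG s : is_derive s (1 : R) G 0.
  rewrite /G; apply: is_derive_eq.
  by rewrite /GRing.scale /=; ring.
have := @is_derive_0_is_cst R G t 0 dG.
rewrite /G mulr0 expR0 mul1r /u /v (expop0 HV HA) -!/(cabs2 _) => <-.
by rewrite mulrA -expRD mulNr addNr expR0 mul1r.
Qed.

Lemma expop_eigen t : exists2 xi, E t e = xi *: e &
  cabs2 xi = expR (- (2 * complex.Re lam) * t).
Proof.
have [e0|e0] := eqVneq (ip e e) 0.
  (* For [e = 0] any multiplier works; this one has the required modulus. *)
  rewrite (ip_def HV e0); exists (cR (expR (- complex.Re lam * t))).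
    by rewrite (bl0 (expop_bounded_linear HV HA t)) scaler0.
  by rewrite cabs2_cR expr2 -expRD; congr expR; ring.
have Ee : E t e = (ip (E t e) e / ip e e) *: e.
  by rewrite mulrC -scalerA -expop_eigen_line scalerA mulVf// scale1r.
exists (ip (E t e) e / ip e e) => //.
have c0 : cabs2 (ip e e) != 0 by rewrite cabs2_eq0.
by rewrite cabs2M cabs2V (ipC HV) cabs2_conj expop_eigen_modulus mulfK.
Qed.

End exponential_eigenvector.

(** * Diagonal operators in a Riesz basis *)

Section riesz_basis_operators.
Context {R : realType} {V : lmodType R[i]} (ip : V -> V -> R[i]).
Hypothesis HV : is_separable_hilbert ip.
Variables (J : countType) (e : J -> V).
Hypothesis He : riesz_basis ip e.

Local Notation N := (hnorm ip).

(** Completeness may supply a list with repetitions, while the Riesz inequalities concern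
    duplicate-free lists; the multiplicities are absorbed into the coefficients. *)
Lemma riesz_span f (eps : R) : 0 < eps -> exists s (x : J -> R[i]),
  uniq s /\ N (f - \sum_(j <- s) x j *: e j) < eps.
Proof.
move=> /(He.1 f)[s [x fx]].
exists (undup s), (fun j => x j *+ count_mem j s); split; first exact: undup_uniq.
rewrite -big_undup_iterop_count in fx; congr (N (f - _) < _): fx.
apply: eq_bigr => j _. exact: (scalerMnl (x j) (e j) (count_mem j s)).
Qed.

Lemma dense_le T S K L Q : bounded_linear ip T K -> bounded_linear ip S L ->
  0 <= Q ->
  (forall s (x : J -> R[i]), uniq s ->
    N (T (\sum_(j <- s) x j *: e j)) <= Q * N (S (\sum_(j <- s) x j *: e j))) ->
  forall z, N (T z) <= Q * N (S z).
Proof.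
move=> HT HS Q0 TS z; apply/ler_addgt0Pr => eps eps0.
have K0 := bl_ge0 HT; have L0 := bl_ge0 HS.
have QL0 : 0 <= Q * L by rewrite mulr_ge0.
(* Replacing [z] by [w] costs at most [K + Q L] times [N (z - w)]; the extra 1 makes the divisor
   positive. *)
have D0 : 0 < K + Q * L + 1 by lra.
have [s [x [us]]] := riesz_span z (divr_gt0 eps0 D0).
set w := \sum_(j <- s) _; rewrite ltr_pdivlMr// => zw.
have n0 := hnorm_ge0 ip (z - w).
have hT : N (T z) <= N (T w) + K * N (z - w).
  rewrite -{1}(subrK w z) (blD HT) addrC (le_trans (hnorm_triangle HV _ _))// lerD2l.
  exact: bl_le HT _.
have hS : N (S w) <= N (S z) + L * N (z - w).
  rewrite -{1}(subrK z w) (blD HS) addrC (le_trans (hnorm_triangle HV _ _))// lerD2l.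
  by rewrite (hdistC HV) (bl_le HS).
have := TS s x us; rewrite -/w => hw.
have := ler_wpM2l Q0 hS; nra.
Qed.

(** Apply the upper Riesz inequality to [T], the lower one to [S], then density of the span. The
    constant depends on the basis alone and is therefore chosen before the operators: this is the
    source of all uniform bounds below. *)
Lemma diagonal_compare : exists2 Q, 0 <= Q &
  forall T S K L (mu nu : J -> R[i]),
    bounded_linear ip T K -> bounded_linear ip S L ->
    (forall j, T (e j) = mu j *: e j) -> (forall j, S (e j) = nu j *: e j) ->
    (forall j, cabs2 (mu j) <= cabs2 (nu j)) ->
  forall z, N (T z) <= Q * N (S z).
Proof.
have [_ [c [C [c0 [C0 cC]]]]] := He.
exists (Num.sqrt (C / c)) => [|T S K L mu nu HT HS Te Se munu]; first exact: sqrtr_ge0.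
apply: (dense_le HT HS) => [|s x us]; first exact: sqrtr_ge0.
rewrite -(ler_pXn2r (ltn0Sn 1)) ?nnegrE ?mulr_ge0 ?sqrtr_ge0 ?hnorm_ge0//.
have Cc0 : 0 <= C / c by rewrite divr_ge0 ?(ltW c0) ?(ltW C0).
rewrite exprMn (sqr_sqrtr Cc0) (bl_sum HT) (bl_sum HS).
under eq_bigr do rewrite (blZ HT) Te scalerA.
under [in leRHS]eq_bigr do rewrite (blZ HS) Se scalerA.
have [_ Tx] := cC s (fun j => x j * mu j) us.
have [Sx _] := cC s (fun j => x j * nu j) us.
rewrite (le_trans Tx)// -mulrA ler_wpM2l ?(ltW C0)// mulrC ler_pdivlMr// mulrC.
rewrite (le_trans _ Sx)// ler_wpM2l ?(ltW c0)//; apply: ler_sum => j _.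
by rewrite !cabs2M ler_wpM2l ?cabs2_ge0.
Qed.

(** Convergence on the basis extends to finite combinations, and the common bound [Q] extends it to
    the closure of the span. *)
Lemma strong_cvg0 (T : nat -> V -> V) Q : (forall n, bounded_linear ip (T n) Q) ->
  (forall j, (fun n => N (T n (e j))) @ \oo --> (0 : R)) ->
  forall z, (fun n => N (T n z)) @ \oo --> (0 : R).
Proof.
move=> HT Te z.
have Ts s (x : J -> R[i]) :
    (fun n => N (T n (\sum_(j <- s) x j *: e j))) @ \oo --> (0 : R).
  elim: s => [|j s IH].
    rewrite (_ : (fun _ => _) = (fun=> 0)); first exact: cvg_cst.
    by apply/funext => n; rewrite big_nil (bl0 (HT n)) (hnorm0 HV).
  have IH' : (fun n => Num.sqrt (cabs2 (x j)) * N (T n (e j)) +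
      N (T n (\sum_(k <- s) x k *: e k))) @ \oo --> (0 : R).
    rewrite -[X in _ --> X]addr0; apply: cvgD IH.
    by rewrite -[X in _ --> X](mulr0 (Num.sqrt (cabs2 (x j)))); exact: cvgMr.
  apply: cvg0_le IH' => n; rewrite hnorm_ge0 big_cons (blD (HT n)) (blZ (HT n)).
  by rewrite (le_trans (hnorm_triangle HV _ _))// (hnormZ HV).
(* The approximation error, magnified by [Q], takes at most half of [eps]; the other half is for
   [T n w]. *)
have Q0 := bl_ge0 (HT 0%N); have Q1 : 0 < 2 * (Q + 1) by lra.
apply/cvgrPdist_lt => eps eps0.
have [s [x [_]]] := riesz_span z (divr_gt0 eps0 Q1).
set w := \sum_(j <- s) _; rewrite ltr_pdivlMr// => zw.
have n0 := hnorm_ge0 ip (z - w).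
have e2 : 0 < eps / 2 by lra.
move/cvgrPdist_lt : (Ts s x) => /(_ _ e2); apply: filterS => n.
rewrite !sub0r !normrN !ger0_norm ?hnorm_ge0// -/w => Tw.
rewrite -(subrK w z) (blD (HT n)) (le_lt_trans (hnorm_triangle HV _ _))//.
have := bl_le (HT n) (z - w); nra.
Qed.

(** Finite combinations near [y] have preimages obtained by dividing each coefficient by [mu j]. The
    lower bound on [T] makes these preimages Cauchy, and their limit is sent to [y]. *)
Lemma diagonal_surjective T K Q (mu : J -> R[i]) : bounded_linear ip T K ->
  (forall j, T (e j) = mu j *: e j) -> (forall j, mu j != 0) ->
  0 <= Q -> (forall z, N z <= Q * N (T z)) ->
  forall y, exists z, T z = y.
Proof.
move=> HT Te mu0 Q0 TQ y.
have /choice[z zP] : forall n : nat, exists z, N (T z - y) < n.+1%:R^-1.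
  move=> n; have [|s [x [_ yx]]] := @riesz_span y (n.+1%:R^-1).
    by rewrite invr_gt0.
  exists (\sum_(j <- s) (x j / mu j) *: e j); rewrite (hdistC HV) (bl_sum HT).
  by under eq_bigr do rewrite (blZ HT) Te scalerA divfK//.
have Tzy : hcvg ip (fun n => T (z n)) y.
  apply/hcvgP => //; apply: cvg0_le (@cvg_harmonic R) => n.
  by rewrite hnorm_ge0 (ltW (zP n)).
have /(h_complete HV)[l zl] : hcauchy ip z.
  move=> eps eps0; have Q1 : 0 < 2 * (Q + 1) by lra.
  have [n nP] := Tzy _ (divr_gt0 eps0 Q1); exists n => m p nm np.
  rewrite (le_lt_trans (TQ _))// (blB HT).
  have := nP _ nm; have := nP _ np; rewrite !ltr_pdivlMr//.
  have := hnorm_distD HV y (T (z m)) (T (z p)); rewrite (hdistC HV y).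
  have := hnorm_ge0 ip (T (z m) - y); have := hnorm_ge0 ip (T (z p) - y).
  nra.
by exists l; have Tl := bl_hcvg HT zl; exact: (hcvg_unique HV Tl Tzy).
Qed.

End riesz_basis_operators.

(** * Integrating the derivative of a square *)

Section square_balance.
Context {R : realType}.
Local Notation mu := (@lebesgue_measure R).

Lemma continuous_sqr (f : R -> R) : continuous f ->
  continuous (fun t => f t ^+ 2).
Proof.
move=> cf t; rewrite (_ : (fun _ => _) = f \* f); first exact: continuousM (cf t) (cf t).
by apply/funext => s; rewrite /= expr2.
Qed.

(** The fundamental theorem of calculus for [y ^ 2], arranged additively so that only nonnegative
    terms occur and no extended-real subtraction arises. *)
Lemma integral_sqr_balance (y p q : R -> R) (T : R) : 0 < T ->
  continuous p -> continuous q ->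
  (forall t, is_derive t (1 : R) (fun s => y s ^+ 2) (p t ^+ 2 - q t ^+ 2)) ->
  (\int[mu]_(t in `[0%R, T]) (p t ^+ 2)%:E + (y 0 ^+ 2)%:E =
   \int[mu]_(t in `[0%R, T]) (q t ^+ 2)%:E + (y T ^+ 2)%:E)%E.
Proof.
move=> T0 /continuous_sqr cp /continuous_sqr cq dy.
pose d := fun t => p t ^+ 2 - q t ^+ 2.
have cd : continuous d by move=> t; exact: continuousB (cp t) (cq t).
have cy : continuous (fun s => y s ^+ 2).
  by move=> t; apply/differentiable_continuous/derivable1_diffP; have [] := dy t.
have int (f : R -> R) : continuous f -> mu.-integrable `[0%R, T] (EFin \o f).
  move=> cf; apply: continuous_compact_integrable; first exact: segment_compact.
  exact: continuous_subspaceT.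
have -> : (\int[mu]_(t in `[0%R, T]) (p t ^+ 2)%:E =
    \int[mu]_(t in `[0%R, T]) (d t)%:E + \int[mu]_(t in `[0%R, T]) (q t ^+ 2)%:E)%E.
  rewrite -(integralD _ (int _ cd) (int _ cq))//; apply: eq_integral => t _.
  by rewrite -EFinD /d subrK.
rewrite (continuous_FTC2 (F := fun s => y s ^+ 2) T0).
- by rewrite addeAC -EFinB -EFinD subrK addeC.
- exact: continuous_subspaceT.
- split=> [t _||]; first by have [] := dy t.
  + exact/cvg_at_right_filter/cy.
  + exact/cvg_at_left_filter/cy.
- by move=> t _; rewrite derive1E; have [] := dy t.
Qed.

End square_balance.

(** * The energy identity for one real functional *)

Section energy_identity.
Context {R : realType} {V : lmodType R[i]} (ip : V -> V -> R[i]).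
Hypothesis HV : is_separable_hilbert ip.
Variables (A B : V -> V) (M Q : R).
Hypothesis HA : bounded_linear ip A M.
Hypothesis AB : forall x, B (A x) = A (B x).

Local Notation N := (hnorm ip).
Local Notation E := (expop ip A).
Local Notation mu := (@lebesgue_measure R).

Hypothesis HBn : forall n, bounded_linear ip (iter n B) Q.
Hypothesis HE : forall t, 0 <= t -> bounded_linear ip (E t) Q.
Hypothesis B_stable : forall z, (fun n => N (iter n B z)) @ \oo --> (0 : R).
Hypothesis E_stable : forall z, (fun n : nat => N (E n%:R z)) @ \oo --> (0 : R).

Variables (a g : V).
Hypothesis a_sum : cR (Num.sqrt 2) *: a = B g + g.
Hypothesis Aa_diff : cR (Num.sqrt 2) *: A a = B g - g.

Variables (l : V -> R) (L : R).
Hypothesis Hl : real_functional ip l L.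

Let q n t := l (E t (iter n B g)).
Let y n t := l (E t (iter n B a)).

Let BnA n x : iter n B (A x) = A (iter n B x).
Proof. by elim: n => //= n ->; rewrite AB. Qed.

Let derive_y_sqr n t :
  is_derive t (1 : R) (fun s => y n s ^+ 2) (q n.+1 t ^+ 2 - q n t ^+ 2).
Proof.
have dy := is_derive_expop HV HA t (iter n B a) Hl.
apply: is_derive_eq; rewrite -/(y n t) /GRing.scale /= -BnA.
have HlE x z : l (E t (iter n B (x + z))) = l (E t (iter n B x)) + l (E t (iter n B z)).
  by rewrite (blD (HBn n)) (blD (expop_bounded_linear HV HA t)) (rfD Hl).
have HlZ s x : l (E t (iter n B (cR s *: x))) = s * l (E t (iter n B x)).
  by rewrite (blZ (HBn n)) (blZ (expop_bounded_linear HV HA t)) (rfZ Hl).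
have ya : Num.sqrt 2 * y n t = q n.+1 t + q n t.
  by rewrite /y -HlZ a_sum HlE /q iterSr.
have yA : Num.sqrt 2 * l (E t (iter n B (A a))) = q n.+1 t - q n t.
  rewrite -HlZ Aa_diff (blB (HBn n)) (blB (expop_bounded_linear HV HA t)) (rfB Hl).
  by rewrite /q iterSr.
have s2 : Num.sqrt 2 ^+ 2 = 2 :> R by rewrite sqr_sqrtr.
(* The two factors of square root of 2 multiply to the 2 in [(y ^ 2)' = 2 y y']. *)
rewrite subr_sqr -ya -yA; move: s2; set s := Num.sqrt _; set w := l _.
move=> s2; rewrite (_ : s * w * (s * y n t) = s ^+ 2 * w * y n t); last by ring.
by rewrite s2; ring.
Qed.

Let continuous_q n : continuous (q n).
Proof. exact: (@continuous_expop _ _ _ HV _ _ HA l L (iter n B g) Hl). Qed.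

Let measurable_q_sqr n : measurable_fun [set: R] (fun t => q n t ^+ 2).
Proof. exact: continuous_measurable_fun (continuous_sqr (@continuous_q n)). Qed.

Let energy_balance m T : 0 < T ->
  (\int[mu]_(t in `[0%R, T]) (q m t ^+ 2)%:E + (\sum_(n < m) y n 0 ^+ 2)%:E =
   \int[mu]_(t in `[0%R, T]) (q 0%N t ^+ 2)%:E + (\sum_(n < m) y n T ^+ 2)%:E)%E.
Proof.
move=> T0; elim: m => [|m IH]; first by rewrite !big_ord0.
rewrite !big_ord_recr /= !EFinD addeCA addeC.
rewrite (integral_sqr_balance T0 (@continuous_q _) (@continuous_q m) (derive_y_sqr m)).
by rewrite addeAC IH addeA.
Qed.

Let y0 n : y n 0 = l (iter n B a).
Proof. by rewrite /y (expop0 HV HA). Qed.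

(** Here [m] is fixed and [T] grows: each of the finitely many boundary terms [y n T ^ 2] vanishes
    by [E_stable]. *)
Let sum_le_integral m :
  ((\sum_(n < m) l (iter n B a) ^+ 2)%:E <=
   \int[mu]_(t in `[0%R, +oo[) (l (E t g) ^+ 2)%:E)%E.
Proof.
have W0 : (fun k : nat => \sum_(n < m) y n k%:R ^+ 2) @ \oo --> (0 : R).
  elim: m => [|m' IH].
    rewrite (_ : (fun _ => _) = (fun=> 0)); first exact: cvg_cst.
    by apply/funext => k; rewrite big_ord0.
  rewrite (_ : (fun _ => _) =
      (fun k : nat => \sum_(n < m') y n k%:R ^+ 2 + y m' k%:R ^+ 2)); last first.
    by apply/funext => k; rewrite big_ord_recr.
  rewrite -[X in _ --> X]addr0; apply: cvgD IH _.
  have LN : (fun k : nat => L ^+ 2 * N (E k%:R (iter m' B a)) ^+ 2) @ \oo --> (0 : R).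
    rewrite -[X in _ --> X](mulr0 (L ^+ 2)); apply: cvgMr.
    by rewrite -[X in _ --> X](mulr0 0); apply: cvgM.
  apply: cvg0_le LN => k; rewrite sqr_ge0 -exprMn -(real_normK (num_real (y m' _))).
  by rewrite lerXn2r ?nnegrE ?(le_trans _ (rf_le Hl _))// (rf_le Hl).
apply/lee_addgt0Pr => eps eps0.
move/cvgrPdist_lt : W0 => /(_ _ eps0)[k _ kP].
(* The time [k.+1] is used because [energy_balance] needs a positive end point. *)
have := kP k.+1 (leqnSn k); rewrite /= sub0r normrN ger0_norm; last first.
  by apply: sumr_ge0 => n _; exact: sqr_ge0.
move=> /ltW Wk; under eq_bigr do rewrite -y0.
apply: (@le_trans _ _ (\int[mu]_(t in `[0%R, k.+1%:R]) (q 0%N t ^+ 2)%:E +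
    (\sum_(n < m) y n k.+1%:R ^+ 2)%:E)%E).
  rewrite -energy_balance// leeDr//; apply: integral_ge0 => t _.
  by rewrite lee_fin sqr_ge0.
rewrite leeD ?lee_fin//; apply: ge0_subset_integral => //.
- by apply/measurable_EFinP; apply: measurable_funTS; exact: measurable_q_sqr.
- by move=> t _; rewrite lee_fin sqr_ge0.
- by move=> t /=; rewrite !in_itv/= => /andP[->].
Qed.

(** Here the end point is fixed and [m] grows: the integral of [q m ^ 2] vanishes because
    [N (iter m B g)] does, uniformly in time thanks to [Q]. *)
Let integral_le_sum (k : nat) :
  (\int[mu]_(t in `[0%R, k%:R]) (l (E t g) ^+ 2)%:E <=
   \sum_(n <oo) (l (iter n B a) ^+ 2)%:E)%E.
Proof.
case: k => [|k].
  rewrite set_itv1 integral_set1; apply: nneseries_ge0 => n _ _.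
  by rewrite lee_fin sqr_ge0.
set T : R := k.+1%:R; have T0 : 0 < T by [].
have q0 : (fun m => (L * Q * N (iter m B g)) ^+ 2 * T) @ \oo --> (0 : R).
  rewrite -[X in _ --> X](mul0r T); apply: cvgMl; rewrite -[X in _ --> X](mulr0 0).
  have Nm : (fun m => L * Q * N (iter m B g)) @ \oo --> (0 : R).
    by rewrite -[X in _ --> X](mulr0 (L * Q)); exact: cvgMr.
  by apply: cvgM.
apply/lee_addgt0Pr => eps eps0.
move/cvgrPdist_lt : q0 => /(_ _ eps0)[m _ /(_ m (leqnn m))].
rewrite /= sub0r normrN ger0_norm => [qm|]; last first.
  by apply: mulr_ge0; [exact: sqr_ge0|exact: ltW].
have int_qm : (\int[mu]_(t in `[0%R, T]) (q m t ^+ 2)%:E <= eps%:E)%E.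
  apply: (@le_trans _ _ (\int[mu]_(t in `[0%R, T])
      (cst (((L * Q * N (iter m B g)) ^+ 2)%:E) t))%E).
    apply: ge0_le_integral => //.
    - by move=> t _; rewrite lee_fin sqr_ge0.
    - by apply/measurable_EFinP; apply: measurable_funTS; exact: measurable_q_sqr.
    - move=> t /=; rewrite in_itv/= => /andP[t0 _]; rewrite lee_fin.
      rewrite -(real_normK (num_real (q m t))).
      have qle : `|q m t| <= L * Q * N (iter m B g).
        rewrite (le_trans (rf_le Hl _))// -mulrA ler_wpM2l ?(rf_ge0 Hl)//.
        exact: bl_le (HE t0) _.
      by rewrite lerXn2r ?nnegrE ?(le_trans _ qle).
  rewrite integral_cst//= lebesgue_measure_itv/= lte_fin T0 -EFinD subr0 -EFinM.
  by rewrite lee_fin ltW.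
apply: (@le_trans _ _ (\int[mu]_(t in `[0%R, T]) (q 0%N t ^+ 2)%:E +
    (\sum_(n < m) y n T ^+ 2)%:E)%E).
  by rewrite leeDl// lee_fin sumr_ge0// => n _; rewrite sqr_ge0.
rewrite -energy_balance// addeC leeD//.
rewrite -sumEFin -(big_mkord xpredT (fun n => (y n 0 ^+ 2)%:E)).
under eq_bigr do rewrite y0.
by apply: nneseries_lim_ge => n _ _; rewrite lee_fin sqr_ge0.
Qed.

Lemma energy_identity :
  (\int[mu]_(t in `[0%R, +oo[) (l (E t g) ^+ 2)%:E =
   \esum_(n in [set: nat]) (l (iter n B a) ^+ 2)%:E)%E.
Proof.
have s0 n : (0 <= (l (iter n B a) ^+ 2)%:E)%E by rewrite lee_fin sqr_ge0.
rewrite -nneseries_esumT//; apply/eqP; rewrite eq_le; apply/andP; split.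
  (* The half-line integral is the limit of the integrals up to integer end points. *)
  have lim := @ge0_cvgn_integral _ mu (fun t => l (E t g) ^+ 2).
  rewrite -(cvg_lim _ (lim _ _))//; first last.
  - exact: (measurable_q_sqr 0).
  - by move=> t; exact: sqr_ge0.
  apply: lime_le; last exact: nearW integral_le_sum.
  apply/cvg_ex; eexists; apply: lim => [t|]; first exact: sqr_ge0.
  exact: (measurable_q_sqr 0).
apply: lime_le; first exact: is_cvg_nneseries.
apply: nearW => m; rewrite big_mkord sumEFin; exact: sum_le_integral.
Qed.

End energy_identity.

(** * The Cayley transform and its diagonal form *)

Section cayley_transform.
Context {R : realType} {V : lmodType R[i]} (ip : V -> V -> R[i]).
Hypothesis HV : is_separable_hilbert ip.
Variables (A B : V -> V) (M : R).
Hypothesis HA : bounded_linear ip A M.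
Variables (J : countType) (e : J -> V) (lam : J -> R[i]).
Hypothesis He : riesz_basis ip e.
Hypothesis Heig : forall j, A (e j) = - lam j *: e j.
Hypothesis Hlam : forall j, 0 < complex.Re (lam j).
Hypothesis HB : forall x, B (x - A x) = x + A x.

Local Notation N := (hnorm ip).
Local Notation E := (expop ip A).
Local Notation mu := (@lebesgue_measure R).

Let h j := (1 - lam j) / (1 + lam j).

Let id_bounded_linear : bounded_linear ip id 1.
Proof. by split=> // x; rewrite mul1r. Qed.

Let id_eig j : id (e j) = 1 *: e j.
Proof. by rewrite scale1r. Qed.

Let cabs2_1 : cabs2 (1 : R[i]) = 1.
Proof. by rewrite /cabs2 /= expr0n expr1n addr0. Qed.

Let add_bounded_linear : bounded_linear ip (fun x => x + A x) (1 + M).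
Proof.
split=> [x y|a x||x].
- by rewrite (blD HA) addrACA.
- by rewrite (blZ HA) scalerDr.
- by rewrite addr_ge0// (bl_ge0 HA).
- by rewrite (le_trans (hnorm_triangle HV _ _))// mulrDl mul1r lerD2l (bl_le HA).
Qed.

Let sub_bounded_linear : bounded_linear ip (fun x => x - A x) (1 + M).
Proof.
split=> [x y|a x||x].
- by rewrite (blD HA) opprD addrACA.
- by rewrite (blZ HA) scalerBr.
- by rewrite addr_ge0// (bl_ge0 HA).
- by rewrite (le_trans (hnorm_triangleB HV _ _))// mulrDl mul1r lerD2l (bl_le HA).
Qed.

Let sub_eig j : e j - A (e j) = (1 + lam j) *: e j.
Proof. by rewrite Heig scaleNr opprK scalerDl scale1r. Qed.

Let cabs2_1D j : 1 < cabs2 (1 + lam j).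
Proof. by have := Hlam j; case: (lam j) => a b /= a0; rewrite /cabs2 /=; nra. Qed.

Let add_lam_neq0 j : 1 + lam j != 0.
Proof. by rewrite -cabs2_eq0 gt_eqF// (lt_trans ltr01 (cabs2_1D j)). Qed.

(** The difference [|1 + lam| ^ 2 - |1 - lam| ^ 2] equals [4 Re(lam)], which is positive. *)
Let cabs2_h j : cabs2 (h j) < 1.
Proof.
rewrite cabs2M cabs2V ltr_pdivrMr ?(lt_trans ltr01 (cabs2_1D j))// mul1r.
by have := Hlam j; case: (lam j) => a b /= a0; rewrite /cabs2 /=; nra.
Qed.

(** The identity has multipliers 1 and [1 - A] has multipliers [1 + lam j] of modulus above 1, so
    [diagonal_compare] applies. *)
Let sub_bounded_below : exists2 Q, 0 <= Q & forall z, N z <= Q * N (z - A z).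
Proof.
have [Q Q0 HQ] := diagonal_compare HV He; exists Q => // z.
apply: (HQ _ _ _ _ _ _ id_bounded_linear sub_bounded_linear id_eig sub_eig).
by move=> j; rewrite cabs2_1 ltW.
Qed.

Let sub_surjective y : exists z, z - A z = y.
Proof.
have [Q Q0 HQ] := sub_bounded_below.
exact: (diagonal_surjective HV He sub_bounded_linear sub_eig add_lam_neq0 Q0 HQ).
Qed.

(** [HB] prescribes [B] on the range of [1 - A]. That range is all of [V], so linearity transfers
    from [1 + A], and the lower bound on [1 - A] bounds [B]. *)
Lemma cayley_bounded_linear : exists K, bounded_linear ip B K.
Proof.
have [Q Q0 HQ] := sub_bounded_below; exists ((1 + M) * Q).
have M1 : 0 <= 1 + M by rewrite addr_ge0// (bl_ge0 HA).
split=> [x y|a x||x]; rewrite ?mulr_ge0//.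
- have [z <-] := sub_surjective x; have [w <-] := sub_surjective y.
  by rewrite -(blD sub_bounded_linear) !HB (blD add_bounded_linear).
- have [z <-] := sub_surjective x.
  by rewrite -(blZ sub_bounded_linear) !HB (blZ add_bounded_linear).
- have [z <-] := sub_surjective x; rewrite HB.
  by rewrite (le_trans (bl_le add_bounded_linear z))// -mulrA ler_wpM2l.
Qed.

Lemma cayley_comm x : B (A x) = A (B x).
Proof.
have [z <-] := sub_surjective x.
by rewrite HB (blB HA) HB (blD HA).
Qed.

Let cayley_eig n j : iter n B (e j) = h j ^+ n *: e j.
Proof.
have [K HK] := cayley_bounded_linear.
elim: n => [|n IH]; first by rewrite scale1r.
rewrite iterS IH (blZ HK) exprSr -scalerA; congr (_ *: _).
(* Write [e j] as a multiple of [(1 - A) (e j)], where [HB] gives the value of [B]. *)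
have -> : B (e j) = (1 + lam j)^-1 *: B (e j - A (e j)).
  by rewrite sub_eig (blZ HK) scalerA mulVf// scale1r.
rewrite HB Heig scaleNr -[X in X - _]scale1r -scalerBl scalerA.
by rewrite mulrC.
Qed.

Let expop_eig t : exists xi : J -> R[i], forall j, E t (e j) = xi j *: e j /\
  cabs2 (xi j) = expR (- (2 * complex.Re (lam j)) * t).
Proof.
have /choice[xi xiP] : forall j, exists z, E t (e j) = z *: e j /\
    cabs2 z = expR (- (2 * complex.Re (lam j)) * t).
  by move=> j; have [z] := expop_eigen HV HA (Heig j) t; exists z.
by exists xi.
Qed.

(** All these operators are diagonal with multipliers of modulus at most 1, so comparison with the
    identity bounds them by one [Q]. *)
Lemma contraction_bounds : exists Q,
  (forall n, bounded_linear ip (iter n B) Q) /\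
  (forall t, 0 <= t -> bounded_linear ip (E t) Q).
Proof.
have [Q Q0 HQ] := diagonal_compare HV He; exists Q.
have [K HK] := cayley_bounded_linear; split=> [n|t t0].
  have HBn := bl_iter HK n.
  split=> // [||x]; [exact: blD HBn | exact: blZ HBn |].
  apply: (HQ _ _ _ _ _ _ HBn id_bounded_linear (cayley_eig n) id_eig) => j.
  by rewrite cabs2X cabs2_1 exprn_ile1 ?cabs2_ge0 ?(ltW (cabs2_h j)).
have HEt := expop_bounded_linear HV HA t; have [xi xiP] := expop_eig t.
split=> // [||x]; [exact: blD HEt | exact: blZ HEt |].
apply: (HQ _ _ _ _ _ _ HEt id_bounded_linear (fun j => (xiP j).1) id_eig) => j.
rewrite (xiP j).2 cabs2_1 -expR0 ler_expR mulNr oppr_le0.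
by rewrite !mulr_ge0// ltW.
Qed.

(** Common to both semigroups: [r] will be [cabs2 (h j)] for the powers of [B], and
    [expR (- 2 Re(lam j))] for the exponential at integer times. *)
Let scaled_eig_cvg0 (T : nat -> V -> V) (mu : nat -> R[i]) (r : R) j :
  0 <= r < 1 -> (forall n, T n (e j) = mu n *: e j) ->
  (forall n, cabs2 (mu n) = r ^+ n) -> (fun n => N (T n (e j))) @ \oo --> (0 : R).
Proof.
move=> /andP[r0 r1] Te mur.
rewrite (_ : (fun _ => _) = fun n => Num.sqrt (r ^+ n) * N (e j)).
  rewrite -[X in _ --> X](mul0r (N (e j))); apply: cvgMl; apply: sqrt_cvg0.
  by apply: cvg_expr; rewrite ger0_norm.
by apply/funext => n; rewrite Te (hnormZ HV) mur.
Qed.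

Lemma cayley_stable z : (fun n => N (iter n B z)) @ \oo --> (0 : R).
Proof.
have [Q [HBn _]] := contraction_bounds; apply: (strong_cvg0 HV He HBn) => j.
apply: (@scaled_eig_cvg0 (fun n => iter n B) (fun n => h j ^+ n) (cabs2 (h j))).
- by rewrite cabs2_ge0 cabs2_h.
- by move=> n; rewrite cayley_eig.
- by move=> n; rewrite cabs2X.
Qed.

Lemma expop_stable z : (fun n : nat => N (E n%:R z)) @ \oo --> (0 : R).
Proof.
have [Q [_ HE]] := contraction_bounds.
apply: (@strong_cvg0 _ _ _ HV _ _ He (fun n => E n%:R) Q) => [n|j]; first exact: HE.
have /choice[xi xiP] : forall n : nat, exists z, E n%:R (e j) = z *: e j /\
    cabs2 z = expR (- (2 * complex.Re (lam j)) * n%:R).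
  by move=> n; have [w] := expop_eigen HV HA (Heig j) n%:R; exists w.
apply: (@scaled_eig_cvg0 (fun n => E n%:R) xi (expR (- (2 * complex.Re (lam j))))).
- by rewrite expR_ge0 -expR0 ltr_expR oppr_lt0 mulr_gt0.
- by move=> n; have [] := xiP n.
- by move=> n; have [_ ->] := xiP n; rewrite expRM_natr.
Qed.

Lemma cayley_energy (a g x : V) : a - A a = cR (Num.sqrt 2) *: g ->
  (\int[mu]_(t in `[0%R, +oo[) (cabs2 (ip x (E t g)))%:E =
   \esum_(n in [set: nat]) (cabs2 (ip x (iter n B a)))%:E)%E.
Proof.
move=> ag; have [Q [HBn HE]] := contraction_bounds.
have [K HK] := cayley_bounded_linear.
have Bg : cR (Num.sqrt 2) *: B g = a + A a by rewrite -(blZ HK) -ag HB.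
have s2 : cR (Num.sqrt 2) * cR (Num.sqrt 2) = 2 :> R[i].
  by rewrite -cRM -expr2 sqr_sqrtr// -natr1 cRD.
have s0 : cR (Num.sqrt 2) != 0 :> R[i].
  by rewrite -cabs2_eq0 cabs2_cR sqr_sqrtr// pnatr_eq0.
(* After scaling by the square root of 2 this reads [2 a = (a + A a) + (a - A a)]; the next identity
   is the corresponding difference. *)
have a_sum : cR (Num.sqrt 2) *: a = B g + g.
  apply: (scalerI s0); rewrite scalerA s2 scalerDr Bg -ag addrACA addrN addr0.
  by rewrite scaler_nat mulr2n.
have Aa_diff : cR (Num.sqrt 2) *: A a = B g - g.
  apply: (scalerI s0); rewrite scalerA s2 scalerBr Bg -ag opprB.
  by rewrite addrC addrA subrK scaler_nat mulr2n.
have energy l L (Hl : real_functional ip l L) := energy_identity HV HA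
  cayley_comm HBn HE cayley_stable expop_stable a_sum Aa_diff Hl.
have meas l L : real_functional ip l L -> measurable_fun (`[0%R, +oo[ : set R)
    (fun t => (l (E t g) ^+ 2)%:E).
  move=> Hl; apply/measurable_EFinP; apply: measurable_funTS.
  apply: continuous_measurable_fun (continuous_sqr _).
  exact: (@continuous_expop _ _ _ HV _ _ HA l L g Hl).
have HRe := real_functional_Re HV x; have HIm := real_functional_Im HV x.
(* The squared modulus splits into squares of two real functionals, each obeying the energy
   identity. *)
rewrite /cabs2; under eq_integral do rewrite EFinD.
rewrite ge0_integralD//=; first last.
- exact: meas HIm.
- by move=> t _; rewrite lee_fin sqr_ge0.
- exact: meas HRe.
- by move=> t _; rewrite lee_fin sqr_ge0.
rewrite (energy _ _ HRe) (energy _ _ HIm).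
rewrite -esumD//= => n _; by rewrite lee_fin sqr_ge0.
Qed.

End cayley_transform.

(** * Equivalence of the two frame conditions *)

Theorem mainTheorem10 (R : realType) (V : lmodType R[i]) (ip : V -> V -> R[i])
  (HV : is_separable_hilbert ip)
  (A : {linear V -> V}) (HA : bounded_op ip A)
  (J : countType) (e : J -> V) (He : riesz_basis ip e)
  (lam : J -> R[i])
  (Heig : forall j : J, A (e j) = - lam j *: e j)
  (Hlam : forall j : J, 0 < complex.Re (lam j))
  (I : countType) (g : I -> V)
  (a : I -> V) (Ha : forall i : I, a i - A (a i) = cR (Num.sqrt 2) *: g i)
  (B : V -> V) (HB : forall x : V, B (x - A x) = x + A x) :
  semicont_frame ip A g `[0%R, +oo[ <->
  frame ip (fun p : I * nat => iter p.2 B (a p.1)).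
Proof.
have [M HM] := HA.
(* The absolute value supplies the nonnegative bound that [bounded_linear] demands. *)
have HAM : bounded_linear ip A `|M|.
  split=> [x y|b x||x]; [exact: raddfD|exact: linearZ|by []|].
  by rewrite (le_trans (HM x))// ler_wpM2r ?hnorm_ge0 ?ler_norm.
have frame_sums x : (\esum_(i in [set: I]) \int[lebesgue_measure]_(t in `[0%R, +oo[)
      (cabs2 (ip x (expop ip A t (g i))))%:E =
    \esum_(p in [set: I * nat]) (cabs2 (ip x (iter p.2 B (a p.1))))%:E)%E.
  under eq_esum do rewrite (cayley_energy HV HAM He Heig Hlam HB x (Ha _)).
  rewrite (esum_esum (a := fun i n => (cabs2 (ip x (iter n B (a i))))%:E)).
    by congr esum; apply/seteqP; split=> // -[].
  by move=> i n _ _; rewrite lee_fin cabs2_ge0.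
(* The two frame sums coincide for every [x], so the same [c] and [C] serve in both directions. *)
by rewrite /semicont_frame /frame; split=> -[c [C [c0 [C0 cC]]]]; exists c, C;
  do 2 split=> //; move=> x; move: (cC x); rewrite frame_sums.
Qed.
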